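(* Let $q$ be a prime power, let $X$ be a vector space over $\mathbb{F}_q$ of finite dimension $n\ge 1$, and let $A \subseteq X$ be a subset. For all $i \in \mathbb{N}$ we have $$w_i(\mathcal{L}(A)) = \sum_{k=0}^i \alpha_k(X,A) \begin{bmatrix} n-k \\ i-k \end{bmatrix}_q (-1)^{i-k} q^{\binom{i-k}{2}}.$$
   Context: $\mathbb{N}$ includes $0$. $\begin{bmatrix} r\\ s\end{bmatrix}_q$ is the $q$-binomial coefficient ($0$ if $s<0$ or $s>r$). For $A\subseteq X$, $\mathcal{L}(A)$ is the lattice, ordered by inclusion, of those subspaces of $X$ that have a basis made of elements of $A$, together with the zero space; it is a finite geometric lattice whose rank function is the $\mathbb{F}_q$-dimension. With $\mu_A$ its Möbius function, its $i$-th Whitney number (of the first kind) is $w_i(\mathcal{L}(A))=\sum_{U\in\mathcal{L}(A),\ \dim U=i}\mu_A(\{0\},U)$ (an empty sum is $0$). The number $\alpha_k(X,A)$ is the number of $k$-dimensional subspaces $V\le X$ that distinguish (avoid) $A$, i.e. with $V\cap A=\emptyset$ or $V\cap A=\{0\}$. *)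

(* Defs.v *)
From HB Require Import structures.
From mathcomp Require Import all_boot all_order all_algebra all_field.

Set Implicit Arguments.
Unset Strict Implicit.
Unset Printing Implicit Defensive.

Import Order.TTheory GRing.Theory Num.Theory.
Local Open Scope ring_scope.

HB.instance Definition _ (F : finFieldType) (X : vectType F) :=
  Choice_isCountable.Build {vspace X}
    (pcan_pickleK (can_pcan (@VectorInternalTheory.vs2mxK F X))).
HB.instance Definition _ (F : finFieldType) (X : vectType F) :=
  isFinite.Build {vspace X}
    (pcan_enumP (can_pcan (@VectorInternalTheory.vs2mxK F X))).

Section Mobius.

Variables (T : finType) (le : rel T) (S : {set T}).

(* mu(x, x) = 1 and mu(x, y) = - \sum_(x <= z < y) mu(x, z), the sum being over
   z in S; m bounds the recursion depth, and #|T| is enough by mobius_neq. When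
   x <= y fails the sum is empty (for transitive le), so the value is 0. *)
Fixpoint mobius_rec (m : nat) (x y : T) : int :=
  if x == y then 1
  else if m is m'.+1 then
    - \sum_(z in S | [&& le x z, le z y & z != y]) mobius_rec m' x z
  else 0.

Definition mobius (x y : T) : int := mobius_rec #|T| x y.

Lemma mobius_refl x : mobius x x = 1.
Proof. by rewrite /mobius; case: #|T| => [|m] /=; rewrite eqxx. Qed.

Hypotheses (le_anti : antisymmetric le) (le_trans : transitive le).

Let below y := [set z | le z y & z != y].

Lemma below_proper z y : le z y -> z != y -> below z \proper below y.
Proof.
move=> lezy neqzy; apply/properP; split; last first.
  by exists z; rewrite !inE ?eqxx ?andbF // lezy.
apply/subsetP => t; rewrite !inE => /andP[letz neqtz].
rewrite (le_trans letz lezy) /=; apply: contra neqtz => /eqP eqty.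
by rewrite -eqty in lezy; apply/eqP/le_anti; rewrite letz lezy.
Qed.

Lemma mobius_rec_stable m1 m2 x y :
  (#|below y| < m1)%N -> (#|below y| < m2)%N ->
  mobius_rec m1 x y = mobius_rec m2 x y.
Proof.
elim: m1 m2 y => [|m1 IHm] [|m2] y //= lt1 lt2.
case: ifP => // _; congr (- _); apply: eq_bigr => z /and4P[_ _ lezy neqzy].
have /proper_card lt := below_proper lezy neqzy.
by apply: IHm; apply: leq_trans lt _.
Qed.

Lemma mobius_neq x y : x != y ->
  mobius x y = - \sum_(z in S | [&& le x z, le z y & z != y]) mobius x z.
Proof.
move=> neqxy.
have bnd z : (#|below z| < #|T|)%N.
  rewrite -cardsT; apply: proper_card; apply/properP; split; first exact: subsetT.
  by exists z; rewrite !inE ?eqxx ?andbF.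
have -> : mobius x y = mobius_rec #|T|.+1 x y.
  by apply: mobius_rec_stable; rewrite ?ltnS ?bnd // ltnW ?bnd.
by rewrite /= (negbTE neqxy).
Qed.

End Mobius.

Section Subspaces.

Variables (F : finFieldType) (X : vectType F).
Implicit Types (A : {set finvect_type X}) (U V : {vspace X}).

(* The zero space is included through the empty basis already. *)
Definition spanned_lattice A : {set {vspace X}} :=
  [set U | (U == 0%VS) ||
     [exists B : {set finvect_type X}, (B \subset A) && basis_of U (enum B : seq X)]].

Definition whitney A (i : nat) : int :=
  \sum_(U in spanned_lattice A | \dim U == i)
    mobius (fun V W : {vspace X} => (V <= W)%VS) (spanned_lattice A) 0%VS U.

Definition distinguishes V A : bool :=
  let I := [set x in A | (x : X) \in V] in (I == set0) || (I == [set 0]).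

Definition num_distinguishing A (k : nat) : nat :=
  #|[set V : {vspace X} | (\dim V == k) && distinguishes V A]|.

End Subspaces.

(* In the product, factor j = 0 .. s-1 is (q^(r-j) - 1) / (q^(j+1) - 1). *)
Definition qbinom (q r s : nat) : rat :=
  if (s <= r)%N then
    \prod_(j < s) ((q%:R ^+ (r - j) - 1) / (q%:R ^+ j.+1 - 1))
  else 0.

(* Main.v *)
Require Import Defs.
From mathcomp Require Import all_boot all_order all_algebra all_field.
From mathcomp Require Import ring.

Set Implicit Arguments.
Unset Strict Implicit.
Unset Printing Implicit Defensive.

Import Order.TTheory GRing.Theory Num.Theory.
Local Open Scope ring_scope.

(** Write L for the lattice of A, mu for its Moebius function from the zero
    space, and w_j for its Whitney numbers.

    Distinguishing subspaces are detected by mu. Every subspace V contains a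
    largest member of L, the span C of the elements of A lying in V: a member
    of L is below V exactly when it is below C. Moreover V distinguishes A
    exactly when C = 0. The defining property of mu on the interval [0, C] then
    says that the sum of mu(U) over the U in L below V is 1 if V distinguishes
    A and 0 otherwise ([distinguishes_mobius]).

    Summing this over all V of dimension k and exchanging the sums, each U in L
    is counted once for each k-dimensional V above it, and the number of those
    is a Gaussian binomial ([card_superspaces]). Hence
      alpha_k = \sum_(j <= k) w_j * [n - j, k - j]_q
    ([num_distinguishing_mobius], with the sum over j left as a sum over U).

    This triangular system is inverted by the orthogonality relation
      \sum_(t <= s) [r, t]_q [r - t, s - t]_q (-1)^(s-t) q^C(s-t, 2) = [s = 0]
    ([qbinom_orthogonality]): substituting alpha_k in the right-hand side of the
    theorem, the coefficient of mu(U) is the left-hand side of that relation at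
    r = n - dim U and s = i - dim U, so only the U of dimension i survive. *)

(** * Gaussian binomials *)

(** For r < s the factor j = r of the product is zero, so the product formula,
    and with it the recurrences derived from it, hold for all r and s. *)
Lemma qbinom_prod (q r s : nat) :
  qbinom q r s = \prod_(j < s) ((q%:R ^+ (r - j) - 1) / (q%:R ^+ j.+1 - 1)).
Proof.
rewrite /qbinom; case: leqP => // lt_rs.
by rewrite (bigD1 (Ordinal lt_rs)) //= subnn expr0 subrr !mul0r.
Qed.

Lemma qbinom0 (q r : nat) : qbinom q r 0 = 1.
Proof. by rewrite qbinom_prod big_ord0. Qed.

Lemma qbinom_small (q r s : nat) : (r < s)%N -> qbinom q r s = 0.
Proof. by rewrite /qbinom ltnNge => /negbTE ->. Qed.

Lemma qbinom_recr (q r s : nat) :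
  qbinom q r s.+1 =
    qbinom q r s * ((q%:R ^+ (r - s) - 1) / (q%:R ^+ s.+1 - 1)).
Proof. by rewrite !qbinom_prod big_ord_recr. Qed.

Lemma natrX_sub1_neq0 (q s : nat) :
  (1 < q)%N -> (0 < s)%N -> q%:R ^+ s - 1 != 0 :> rat.
Proof.
move=> q_gt1 s_gt0.
by rewrite subr_eq0 -natrX pnatr_eq1 -(expn0 q) eqn_exp2l // -lt0n.
Qed.

Lemma qbinom_shift_top (q r t : nat) :
  (q%:R ^+ (r.+1 - t) - 1) * qbinom q r.+1 t
    = (q%:R ^+ r.+1 - 1) * qbinom q r t.
Proof.
elim: t => [|t IHt]; first by rewrite !qbinom0 subn0.
have swap (a b c d : rat) : a * (b * (c / d)) = c * b * (a / d) by ring.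
by rewrite !qbinom_recr subSS swap IHt -mulrA.
Qed.

Lemma qbinom_shift_both (q r s : nat) : (1 < q)%N ->
  (q%:R ^+ s.+1 - 1) * qbinom q r.+1 s.+1 = (q%:R ^+ r.+1 - 1) * qbinom q r s.
Proof.
move=> q_gt1; have nz t := natrX_sub1_neq0 q_gt1 (ltn0Sn t).
elim: s => [|s IHs].
  by rewrite qbinom_recr !qbinom0 subn0 mul1r mulrCA divff // mulr1.
rewrite qbinom_recr subSS mulrCA mulrA [_ * (_ / _)]mulrC.
rewrite -mulrA (qbinom_recr q r).
rewrite -[qbinom q r.+1 s.+1](mulKf (nz s)) IHs.
by move: (nz s) (nz s.+1) => nz1 nz2; field; rewrite nz1 nz2.
Qed.

(** The value of the Moebius function on an interval of height s in the lattice
    of all subspaces of a space over a field with q elements. *)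
Definition qsign (q s : nat) : rat := (-1) ^+ s * q%:R ^+ 'C(s, 2).

Lemma qsignS (q s : nat) : qsign q s.+1 = - (q%:R ^+ s * qsign q s).
Proof. by rewrite /qsign binS bin1 exprD exprS; ring. Qed.

(** For s > 0 the sum is zero because it telescopes after multiplication by
    q^s - 1. Splitting q^s - 1 as (q^t - 1) q^(s-t) + (q^(s-t) - 1) in the term
    of index t, the first summand is absorbed in the first Gaussian binomial,
    the second one in the second, and the first part of the term t + 1 is then
    the opposite of the second part of the term t. *)
Lemma qbinom_orthogonality (q r s : nat) : (1 < q)%N ->
  \sum_(t < s.+1) qbinom q r t * qbinom q (r - t) (s - t) * qsign q (s - t)
    = (s == 0%N)%:R.
Proof.
move=> q_gt1; case: s => [|s].
  by rewrite big_ord1 !qbinom0 /qsign expr0 !mulr1.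
case: r => [|r].
  apply: big1 => -[[|t] lt_ts] _ /=.
    by rewrite subn0 (qbinom_small _ (ltn0Sn s)) mulr0 mul0r.
  by rewrite qbinom_small // !mul0r.
apply: (mulfI (natrX_sub1_neq0 q_gt1 (ltn0Sn s))); rewrite mulr0 mulr_sumr.
pose a (t : nat) := (q%:R ^+ t - 1) * qbinom q r.+1 t * q%:R ^+ (s.+1 - t) *
  qbinom q (r.+1 - t) (s.+1 - t) * qsign q (s.+1 - t).
pose b (t : nat) := qbinom q r.+1 t * ((q%:R ^+ (s.+1 - t) - 1) *
  qbinom q (r.+1 - t) (s.+1 - t)) * qsign q (s.+1 - t).
rewrite (eq_bigr (fun t : 'I_s.+2 => a t + b t)); last first.
  move=> t _; rewrite /a /b -{1}(subnKC (ltn_ord t : t <= s.+1)%N) exprD; ring.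
(* The first a and the last b vanish, leaving the sum of a t.+1 + b t. *)
rewrite big_split /= big_ord_recl [X in _ + X]big_ord_recr /=.
rewrite {1}/a expr0 subrr !mul0r add0r.
rewrite /b subnn expr0 subrr mul0r mulr0 mul0r addr0.
rewrite -big_split big1 //= => t _.
rewrite /a /bump /= add1n !subSS qbinom_shift_both //.
rewrite (subSn (ltn_ord t : t <= s)%N) qsignS.
have [le_tr|lt_rt] := leqP t r; last first.
  rewrite (qbinom_small _ lt_rt) (eqP (lt_rt : r.+1 - t == 0)%N).
  by rewrite (qbinom_small _ (ltn0Sn _)) !(mulr0, mul0r) addr0.
rewrite subSn // qbinom_shift_both // -subSn //.
by rewrite (mulrCA (qbinom q r.+1 t)) mulrA qbinom_shift_top; ring.
Qed.

(** * Counting the subspaces above a given subspace *)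

Lemma dim_add_line (F : fieldType) (X : vectType F) (U : {vspace X}) (x : X) :
  x \notin U -> \dim (U + <[x]>) = (\dim U).+1.
Proof.
move=> nUx; rewrite dimv_disjoint_sum.
  by rewrite dim_vline (contraNneq _ nUx) ?addn1 // => ->; rewrite mem0v.
apply/eqP; rewrite -subv0; apply/subvP => y /memv_capP[Uy /vlineP[k def_y]].
rewrite memv0; apply: contraNT nUx => y_neq0.
have k_neq0 : k != 0 by apply: contraNneq y_neq0 => k0; rewrite def_y k0 scale0r.
by rewrite -(scalerK k_neq0 x) -def_y memvZ.
Qed.

Lemma card_vspace_set (F : finFieldType) (X : vectType F) (V : {vspace X}) :
  #|[set x : finvect_type X | x \in V]| = (#|F| ^ \dim V)%N.
Proof.
(* [card_vspace] is stated for an explicitly packed vector space type, which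
   unifies with X only once X is destructed. *)
case: X V => T cT V.
rewrite -(@card_vspace F (finvect_type (Vector.Pack cT)) cT V).
by apply: eq_card => x; rewrite inE.
Qed.

Lemma card_vspaceD (F : finFieldType) (X : vectType F) (U W : {vspace X}) :
  (U <= W)%VS ->
  #|[set x : finvect_type X | (x \in W) && (x \notin U)]|
    = (#|F| ^ \dim W - #|F| ^ \dim U)%N.
Proof.
move=> sUW; rewrite -!card_vspace_set -cardsDS; last first.
  by apply/subsetP => x; rewrite !inE; apply: (subvP sUW).
by apply: eq_card => x; rewrite !inE andbC.
Qed.

(** Induction on m, counting in two ways the pairs (x, W) with W one of the
    subspaces in question for m + 1 and x a vector of W outside U. For a given
    W there are q^(dim W) - q^(dim U) choices of x; for a given x outside U the
    choices of W are the subspaces above U + <[x]> whose dimension exceeds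
    that of U + <[x]> by m, and the induction hypothesis counts them. Divided by
    q^(dim U), the resulting relation is the recurrence [qbinom_shift_both]. *)
Lemma card_superspaces (F : finFieldType) (X : vectType F) (U : {vspace X})
    (m : nat) :
  #|[set W : {vspace X} | (U <= W)%VS && (\dim W == \dim U + m)%N]|%:R
    = qbinom #|F| (\dim {:X} - \dim U) m.
Proof.
elim: m U => [|m IHm] U.
  rewrite qbinom0 addn0 (_ : [set W | _] = [set U]) ?cards1 //.
  apply/setP => W; rewrite !inE [W == U]eq_sym eqEdim.
  by apply: andb_id2l => /dimvS; rewrite eqn_leq andbC => ->.
set S := [set W | _].
pose S_ x := [set W : {vspace X} |
  (U + <[x]> <= W)%VS && (\dim W == \dim (U + <[x]>) + m)%N].
have count : (#|S| * (#|F| ^ (\dim U + m.+1) - #|F| ^ \dim U))%N =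
    (\sum_(x : finvect_type X | x \notin U) #|S_ x|)%N.
  rewrite -sum_nat_const.
  rewrite (eq_bigr (fun W : {vspace X} =>
      \sum_(x : finvect_type X | (x \notin U) && (x \in W)) 1)%N); last first.
    move=> W; rewrite inE => /andP[sUW /eqP <-].
    rewrite -card_vspaceD // -sum1dep_card.
    by apply: eq_bigl => x; rewrite andbC.
  rewrite (exchange_big_dep (fun x : finvect_type X => x \notin U)) /=;
    last by move=> W x _ /andP[].
  apply: eq_bigr => x nUx; rewrite -sum1_card; apply: eq_bigl => W.
  by rewrite !inE nUx dim_add_line // addSnnS subv_add -memvE andbAC.
have q_gt1 := finNzRing_gt1 F.
have := congr1 (fun k : nat => k%:R : rat) count.
set Q := qbinom #|F| (\dim {:X} - (\dim U).+1) m.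
rewrite natrM natr_sum (eq_bigr (fun=> Q)); last first.
  by move=> x nUx; rewrite IHm dim_add_line.
have -> : \sum_(x : finvect_type X | x \notin U) Q
    = (#|F| ^ \dim {:X} - #|F| ^ \dim U)%:R * Q.
  rewrite sumr_const mulr_natl -card_vspaceD ?subvf //; congr (_ *+ _).
  by apply: eq_card => x; rewrite !inE memvf.
have le_U := dimvS (subvf U); rewrite {}/Q; set r := (\dim {:X} - \dim U)%N.
rewrite subnS -/r -{1}(subnKC le_U) -/r.
have q_gt0 : (0 < #|F|)%N by apply: ltnW.
rewrite !natrB ?leq_pexp2l ?leq_addr // !natrX !exprD.
have qU_neq0 : #|F|%:R ^+ \dim U != 0 :> rat.
  by rewrite expf_neq0 // pnatr_eq0 -lt0n.
rewrite -[X in _ * (_ - X)]mulr1 -[X in (_ - X) * _]mulr1 -!mulrBr mulrCA -mulrA.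
move/(mulfI qU_neq0); rewrite mulrC => eq_N.
apply: (mulfI (natrX_sub1_neq0 q_gt1 (ltn0Sn m))); rewrite eq_N.
(* For r = 0 the truncated r.-1 does no harm: both sides are zero. *)
case: r {eq_N} => [|r]; last by rewrite -qbinom_shift_both.
by rewrite expr0 subrr mul0r qbinom_small ?mulr0.
Qed.

(** * The Moebius function detects distinguishing subspaces *)

Lemma sum_mobius (T : finType) (le : rel T) (S : {set T}) (x y : T) :
  reflexive le -> antisymmetric le -> transitive le -> y \in S -> le x y ->
  \sum_(z in S | le x z && le z y) mobius le S x z = (x == y)%:R.
Proof.
move=> le_refl le_anti le_trans Sy lexy; case: eqVneq => [eqxy | neqxy].
  rewrite -{}eqxy in Sy lexy *; rewrite (bigD1 x) /= ?Sy ?lexy // mobius_refl.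
  rewrite big1 ?addr0 // => z /andP[/andP[_ lez] neqz].
  by case/eqP: neqz; apply: le_anti; rewrite andbC.
rewrite (bigD1 y) /= ?Sy ?lexy ?le_refl // mobius_neq // addrC; apply/eqP.
by rewrite subr_eq0; apply/eqP/eq_bigl => z; rewrite -!andbA.
Qed.

(** Restates [mem_enum] for the equality of X, which is not syntactically that
    of [finvect_type X]. *)
Lemma mem_enum_vect (F : finFieldType) (X : vectType F)
    (B : {set finvect_type X}) (x : X) :
  (x \in (enum B : seq X)) = ((x : finvect_type X) \in B).
Proof. exact: (mem_enum B (x : finvect_type X)). Qed.

(** A free subset of I that is maximal for inclusion spans I. *)
Lemma basis_from_set (F : finFieldType) (X : vectType F)
    (I : {set finvect_type X}) :
  exists2 B : {set finvect_type X}, B \subset I &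
    basis_of <<enum I : seq X>> (enum B : seq X).
Proof.
pose P (B : {set finvect_type X}) := (B \subset I) && free (enum B : seq X).
have [|B /maxsetP[/andP[sBI freeB] maxB]] := @ex_maxset _ P.
  by exists set0; rewrite /P sub0set enum_set0 nil_free.
exists B => //; rewrite /basis_of freeB andbT eqEsubv; apply/andP; split.
  by apply: sub_span => x; rewrite !mem_enum_vect; apply: (subsetP sBI).
suff sIB (x : finvect_type X) : x \in I -> (x : X) \in <<enum B : seq X>>%VS.
  by apply/span_subvP => x; rewrite mem_enum_vect => /sIB.
move=> Ix; apply: contraT => nBx.
have nBx' : x \notin B.
  by apply: contra nBx => Bx; rewrite memv_span ?mem_enum_vect.
case/negP: (nBx'); rewrite -(maxB (x |: B)) ?setU11 ?subsetUr // /P.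
rewrite subUset sub1set Ix sBI /=.
rewrite (@perm_free _ _ _ ((x : X) :: (enum B : seq X))) ?free_cons ?nBx //=.
apply: (@uniq_perm (finvect_type X)) => [||y]; first exact: enum_uniq.
  by rewrite /= mem_enum nBx' enum_uniq.
by rewrite !inE !mem_enum !inE.
Qed.

Lemma distinguishes_span (F : finFieldType) (X : vectType F)
    (V : {vspace X}) (A : {set finvect_type X}) :
  distinguishes V A =
    (0%VS == <<enum [set x in A | (x : X) \in V] : seq X>>%VS).
Proof.
rewrite /distinguishes orbC -subset1 eqEsubv sub0v /=.
apply/subsetP/span_subvP => [sI0 x | sI0 x Ix].
  by rewrite mem_enum_vect => /sI0; rewrite inE memv0.
by rewrite inE; have := sI0 x; rewrite mem_enum_vect memv0; apply.
Qed.

Definition mobius_from0 (F : finFieldType) (X : vectType F)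
    (A : {set finvect_type X}) : {vspace X} -> int :=
  mobius (fun V W : {vspace X} => (V <= W)%VS) (spanned_lattice A) 0%VS.

(** V may be replaced by C, the largest member of the lattice below it; then
    the sum is that of the Moebius function over the interval [0, C]. *)
Lemma distinguishes_mobius (F : finFieldType) (X : vectType F)
    (V : {vspace X}) (A : {set finvect_type X}) :
  (distinguishes V A)%:R =
    \sum_(U in spanned_lattice A | (U <= V)%VS) mobius_from0 A U.
Proof.
pose I := [set x in A | (x : X) \in V]; pose C := <<enum I : seq X>>%VS.
have LC : C \in spanned_lattice A.
  have [B sBI bB] := basis_from_set I.
  rewrite inE; apply/orP; right; apply/existsP; exists B; rewrite bB andbT.
  by apply: subset_trans sBI _; apply/subsetP => x; rewrite inE => /andP[].
have sCV : (C <= V)%VS.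
  by apply/span_subvP => x; rewrite mem_enum_vect inE => /andP[].
have le_C U : U \in spanned_lattice A -> (U <= V)%VS = (U <= C)%VS.
  rewrite inE => LU; apply/idP/idP => [sUV | /subv_trans-> //].
  case/orP: LU => [/eqP-> | /existsP[B /andP[sBA bB]]]; first exact: sub0v.
  rewrite -(span_basis bB); apply: sub_span => x.
  rewrite !mem_enum_vect inE => Bx.
  by rewrite (subsetP sBA) //= (subvP sUV) // (basis_mem bB) ?mem_enum_vect.
rewrite distinguishes_span -/I -/C.
rewrite -(@sum_mobius _ (fun V W : {vspace X} => (V <= W)%VS)
            (spanned_lattice A)) ?sub0v //.
- by apply: eq_bigl => U; rewrite sub0v; apply: andb_id2l => /le_C->.
- by move=> U W /andP[sUW sWU]; apply/eqP; rewrite eqEsubv sUW.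
- by move=> W U W'; apply: subv_trans.
Qed.

Lemma num_distinguishing_mobius (F : finFieldType) (X : vectType F)
    (A : {set finvect_type X}) (k : nat) :
  (num_distinguishing A k)%:R =
    \sum_(U in spanned_lattice A | (\dim U <= k)%N)
      (mobius_from0 A U)%:~R * qbinom #|F| (\dim {:X} - \dim U) (k - \dim U).
Proof.
transitivity (\sum_(V : {vspace X} | \dim V == k) (distinguishes V A)%:R : rat).
  rewrite /num_distinguishing -sum1dep_card natr_sum big_mkcondr /=.
  by apply: eq_bigr => V _; case: distinguishes.
transitivity (\sum_(V : {vspace X} | \dim V == k)
    \sum_(U in spanned_lattice A | (U <= V)%VS) (mobius_from0 A U)%:~R : rat).
  apply: eq_bigr => V _.
  by rewrite -rmorph_sum -distinguishes_mobius; case: distinguishes.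
rewrite (exchange_big_dep (fun U : {vspace X} =>
    (U \in spanned_lattice A) && (\dim U <= k)%N)) /=; last first.
  by move=> V U /eqP <- /andP[-> /dimvS].
apply: eq_bigr => U /andP[LU leUk].
rewrite -card_superspaces subnKC // mulr_natr -sumr_const.
by apply: eq_bigl => V; rewrite inE LU andbC.
Qed.

(** * Inversion *)

(* For k > n the truncated n - k is harmless: no subspace has dimension k. *)
Theorem theorem3p1 (q n : nat) (F : finFieldType) (card_F : #|F| = q)
    (X : vectType F) (dim_X : \dim {:X} = n) (n_ge1 : (1 <= n)%N)
    (A : {set finvect_type X}) (i : nat) :
  (whitney A i)%:~R =
    \sum_(0 <= k < i.+1)
      (num_distinguishing A k)%:R * qbinom q (n - k) (i - k)
        * (-1) ^+ (i - k) * q%:R ^+ 'C(i - k, 2) :> rat.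
Proof.
have q_gt1 : (1 < q)%N by rewrite -card_F finNzRing_gt1.
rewrite big_mkord /whitney rmorph_sum /= -/(mobius_from0 A).
pose c (U : {vspace X}) (k : nat) := qbinom q (n - \dim U) (k - \dim U)
  * qbinom q (n - k) (i - k) * qsign q (i - k).
transitivity (\sum_(k < i.+1) \sum_(U in spanned_lattice A | (\dim U <= k)%N)
    (mobius_from0 A U)%:~R * c U k); last first.
  apply: eq_bigr => k _.
  rewrite num_distinguishing_mobius card_F dim_X !mulr_suml.
  by apply: eq_bigr => U _; rewrite /c /qsign !mulrA.
rewrite (exchange_big_dep (fun U : {vspace X} =>
    (U \in spanned_lattice A) && (\dim U <= i)%N)) /=; last first.
  by move=> k U _ /andP[-> leUk]; rewrite (leq_trans leUk) // -ltnS ltn_ord.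
rewrite [LHS]big_mkcond [RHS]big_mkcond /=; apply: eq_bigr => U _.
case: (boolP (U \in _)) => //= LU.
case: leqP => [leUi | lt_iU]; last by rewrite gtn_eqF.
(* The index k is shifted to t = k - dim U. *)
rewrite -mulr_sumr -(big_mkord (fun k => \dim U <= k)%N (c U)).
have -> := esym (big_nat_widenl (\dim U) 0 i.+1 xpredT (c U) (leq0n _)).
rewrite -[index_iota (\dim U) _]/(index_iota (0 + \dim U)%N _) big_addn.
rewrite subSn // big_mkord /c.
under eq_bigr => t _ do rewrite addnK [(t + _)%N]addnC !subnDA.
rewrite qbinom_orthogonality // subn_eq0 eqn_leq leUi /=.
by case: leqP => _; rewrite ?mulr1 ?mulr0.
Qed.
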